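(* Let $T$ be a competitive map on a rectangular set $\mathcal{R}\subset\mathbb{R}^2$ with an isolated fixed point $\overline{\mathrm{x}}\in\mathcal{R}$ such that $\mathcal{R}\cap\mathrm{int}\,(\mathcal{Q}_2(\overline{\mathrm{x}})\cup\mathcal{Q}_4(\overline{\mathrm{x}}))\neq\emptyset$. Suppose $T$ has a $C^1$ extension to a neighborhood of $\overline{\mathrm{x}}$. Let $\mathrm{v}=(\mathrm{v}^{(1)},\mathrm{v}^{(2)})\in\mathbb{R}^2$ be an eigenvector of the Jacobian of $T$ at $\overline{\mathrm{x}}$, with associated eigenvalue $\mu\in\mathbb{R}$, and suppose $\mathrm{v}^{(1)}\mathrm{v}^{(2)}<0$. Assume that $T$ is real analytic at $\overline{\mathrm{x}}$ and that $\mu=1$. Let $c_j,d_j$, $j=2,3,\ldots$ be defined by the Taylor series $$T(\overline{\mathrm{x}}+t\,\mathrm{v})=\overline{\mathrm{x}}+\mathrm{v}\,t+(c_2,d_2)\,t^2+\cdots+(c_n,d_n)\,t^n+\cdots.$$ Suppose that there exists an index $\ell\ge 2$ such that $(c_\ell,d_\ell)\ne(0,0)$ and $(c_j,d_j)=(0,0)$ for $j<\ell$. If either (a) $c_\ell d_\ell<0$, or (b) $c_\ell\ne 0$ and $T(\overline{\mathrm{x}}+t\,\mathrm{v})^{(2)}$ is affine in $t$, or (c) $d_\ell\neq 0$ and $T(\overline{\mathrm{x}}+t\,\mathrm{v})^{(1)}$ is affine in $t$, then there exists an order interval $\mathcal{I}$ which is also a relative neighborhood of $\overline{\mathrm{x}}$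 such that for every relative neighborhood $\mathcal{U}\subset\mathcal{I}$ of $\overline{\mathrm{x}}$ the following statements are true. (i) If $\ell$ is odd and $(c_\ell,d_\ell)\preceq_{se}(0,0)$, then $\mathcal{U}\cap\mathrm{int}\,\mathcal{Q}_4(\overline{\mathrm{x}})$ contains a supersolution and $\mathcal{U}\cap\mathrm{int}\,\mathcal{Q}_2(\overline{\mathrm{x}})$ contains a subsolution. In this case, for every $\mathrm{x}\in\mathcal{I}\cap\mathrm{int}\,(\mathcal{Q}_2(\overline{\mathrm{x}})\cup\mathcal{Q}_4(\overline{\mathrm{x}}))$ there exists $N$ such that $T^n(\mathrm{x})\notin\mathcal{I}$ for $n\ge N$. (ii) If $\ell$ is odd and $(0,0)\preceq_{se}(c_\ell,d_\ell)$, then $\mathcal{U}\cap\mathrm{int}\,\mathcal{Q}_4(\overline{\mathrm{x}})$ contains a subsolution and $\mathcal{U}\cap\mathrm{int}\,\mathcal{Q}_2(\overline{\mathrm{x}})$ contains a supersolution. In this case, $T^n(\mathrm{x})\to\overline{\mathrm{x}}$ for every $\mathrm{x}\in\mathcal{I}$. (iii) If $\ell$ is even and $(c_\ell,d_\ell)\preceq_{se}(0,0)$, then $\mathcal{U}\cap\mathrm{int}\,\mathcal{Q}_4(\overline{\mathrm{x}})$ contains a subsolution and $\mathcal{U}\cap\mathrm{int}\,\mathcal{Q}_2(\overline{\mathrm{x}})$ contains a subsolution. In this case, $T^n(\mathrm{x})\to\overline{\mathrm{x}}$ for every $\mathrm{x}\in\mathcal{I}\cap\mathcal{Q}_4(\overline{\mathrm{x}})$,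 and for every $\mathrm{x}\in\mathcal{I}\cap\mathrm{int}\,\mathcal{Q}_2(\overline{\mathrm{x}})$ there exists $N$ such that $T^n(\mathrm{x})\notin\mathcal{I}$ for $n\ge N$. (iv) If $\ell$ is even and $(0,0)\preceq_{se}(c_\ell,d_\ell)$, then $\mathcal{U}\cap\mathrm{int}\,\mathcal{Q}_2(\overline{\mathrm{x}})$ contains a supersolution and $\mathcal{U}\cap\mathrm{int}\,\mathcal{Q}_4(\overline{\mathrm{x}})$ contains a supersolution. In this case, $T^n(\mathrm{x})\to\overline{\mathrm{x}}$ for every $\mathrm{x}\in\mathcal{I}\cap\mathcal{Q}_2(\overline{\mathrm{x}})$, and for every $\mathrm{x}\in\mathcal{I}\cap\mathrm{int}\,\mathcal{Q}_4(\overline{\mathrm{x}})$ there exists $N$ such that $T^n(\mathrm{x})\notin\mathcal{I}$ for $n\ge N$.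
   Context: A set $\mathcal{R}\subset\mathbb{R}^2$ is rectangular if it is the cartesian product of two intervals in $\mathbb{R}$. A map on $\mathcal{R}$ is a continuous function $T:\mathcal{R}\to\mathcal{R}$; write $T=(f,g)$. $T$ is competitive if $f(x,y)$ is non-decreasing in $x$ and non-increasing in $y$, and $g(x,y)$ is non-increasing in $x$ and non-decreasing in $y$. For $\mathrm{w}\in\mathbb{R}^2$, $\mathrm{w}^{(1)},\mathrm{w}^{(2)}$ are its coordinates. South-East order: $(x,y)\preceq_{se}(s,t)$ iff $x\le s$ and $y\ge t$. Quadrants: $\mathcal{Q}_2(x,y)=\{(u,v):u\le x,\ v\ge y\}$, $\mathcal{Q}_4(x,y)=\{(u,v):u\ge x,\ v\le y\}$; $\mathrm{int}$ denotes interior. A point $\mathrm{x}$ is a subsolution if $T(\mathrm{x})\preceq_{se}\mathrm{x}$ and a supersolution if $\mathrm{x}\preceq_{se}T(\mathrm{x})$. An order interval is a set of the form $\{\mathrm{z}:\mathrm{a}\preceq_{se}\mathrm{z}\preceq_{se}\mathrm{b}\}$, which is the cartesian product of two compact intervals. ''Relative neighborhood'' means neighborhood in the relative topology of $\mathcal{R}$.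
   Formalization: In (i) and (ii) the order condition is imposed on (c_ℓ,d_ℓ) when v^(1)<0 and on −(c_ℓ,d_ℓ) when v^(1)>0, since the literal text fails for v^(1)>0; real analyticity at the fixed point is read as including that the fixed point is interior to the rectangular set. *)

(* Defs.v *)
From HB Require Import structures.
From mathcomp Require Export all_boot all_order all_algebra.
From mathcomp Require Export all_classical all_reals all_analysis.
Set Implicit Arguments.
Unset Strict Implicit.
Unset Printing Implicit Defensive.
Import Order.TTheory GRing.Theory Num.Theory numFieldNormedType.Exports.
Local Open Scope classical_set_scope.
Local Open Scope ring_scope.

Definition rectangular {R : realType} (D : set (R * R)) : Prop :=
  exists A B : set R, [/\ is_interval A, is_interval B & D = A `*` B].

(* A map on D is a total function on the plane of which only the values on D
   matter; all the notions below are insensitive to its values off D. *)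
Definition map_on {R : realType} (D : set (R * R)) (T : R * R -> R * R) : Prop :=
  {within D, continuous T} /\ (forall z, D z -> D (T z)).

Definition competitive {R : realType} (D : set (R * R)) (T : R * R -> R * R)
    : Prop :=
  (forall x x' y, D (x, y) -> D (x', y) -> x <= x' ->
     (T (x, y)).1 <= (T (x', y)).1 /\ (T (x', y)).2 <= (T (x, y)).2) /\
  (forall x y y', D (x, y) -> D (x, y') -> y <= y' ->
     (T (x, y')).1 <= (T (x, y)).1 /\ (T (x, y)).2 <= (T (x, y')).2).

Definition se_le {R : realType} (z w : R * R) : Prop :=
  z.1 <= w.1 /\ w.2 <= z.2.

Definition Q2 {R : realType} (p : R * R) : set (R * R) :=
  [set z | z.1 <= p.1 /\ p.2 <= z.2].

Definition Q4 {R : realType} (p : R * R) : set (R * R) :=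
  [set z | p.1 <= z.1 /\ z.2 <= p.2].

Definition subsolution {R : realType} (T : R * R -> R * R) (z : R * R) : Prop :=
  se_le (T z) z.

Definition supersolution {R : realType} (T : R * R -> R * R) (z : R * R) : Prop :=
  se_le z (T z).

Definition order_interval {R : realType} (I : set (R * R)) : Prop :=
  exists a b : R * R, I = [set z | se_le a z /\ se_le z b].

Definition relative_nbhs {R : realType} (D : set (R * R)) (p : R * R)
    (U : set (R * R)) : Prop :=
  U `<=` D /\ within D (nbhs p) U.

Definition isolated_fixed_point {R : realType} (D : set (R * R))
    (T : R * R -> R * R) (p : R * R) : Prop :=
  [/\ D p, T p = p & \forall z \near p, D z -> T z = z -> z = p].

Definition C1_extension {R : realType} (D : set (R * R))
    (T S : R * R -> R * R) (p : R * R) : Prop :=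
  \forall z \near p, [/\ D z -> S z = T z, differentiable S z &
    forall u : R * R, {for z, continuous ('D_u S)}].

(* Convergence of a double power series means absolute convergence, so the
   square partial sums may be used to compute its sum. *)
Definition is_double_pseries {R : realType} (a : nat -> nat -> R) (h : R * R)
    (s : R) : Prop :=
  summable setT
    (fun ij : nat * nat => (a ij.1 ij.2 * h.1 ^+ ij.1 * h.2 ^+ ij.2)%:E) /\
  (fun n : nat => \sum_(i < n) \sum_(j < n) a i j * h.1 ^+ i * h.2 ^+ j)
    @ \oo --> s.

(* The power series represents T itself, a function with domain D, on a full
   neighborhood of p in the plane; in particular D contains such a
   neighborhood, so that T (p + t v) makes sense for small t of either sign. *)
Definition real_analytic_at {R : realType} (D : set (R * R))
    (T : R * R -> R * R) (p : R * R) : Prop :=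
  exists a b : nat -> nat -> R, \forall z \near p,
    [/\ D z, is_double_pseries a (z - p) (T z).1
           & is_double_pseries b (z - p) (T z).2].

(* The constant and linear terms are p and t v; c 0, c 1, d 0, d 1 are unused. *)
Definition taylor_along {R : realType} (T : R * R -> R * R) (p v : R * R)
    (c d : nat -> R) : Prop :=
  \forall t \near (0 : R),
    (fun n : nat => p + t *: v + \sum_(2 <= j < n) t ^+ j *: (c j, d j))
      @ \oo --> T (p + t *: v).

Definition affine_near0 {R : realType} (h : R -> R) : Prop :=
  exists p q : R, \forall t \near (0 : R), h t = p + q * t.

(* An eigenvector is only determined up to sign, and replacing v by - v changes
   the sign of the Taylor coefficients of odd order. For such an order,
   orient v w is the coefficient w relative to whichever of v, - v points into
   the second quadrant (when v.1 * v.2 < 0). *)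
Definition orient {R : realType} (v w : R * R) : R * R :=
  if v.1 < 0 then w else - w.

(* Main.v *)
(* Along the eigendirection, T (xbar + t v) - (xbar + t v) equals
   t ^ l (c l, d l) up to O(t ^ (l + 1)); each of (a), (b), (c) forces each of
   its components to keep the sign of the leading term or to vanish identically,
   so every xbar + t v with t small is a subsolution or a supersolution, the
   sign of t ^ l (c l, d l) deciding which.  Orbits of such points are monotone
   for the South-East order, hence, as long as they remain in an order interval
   I whose only fixed point is xbar, they converge to xbar.  If the endpoint of I
   moves towards xbar, it drags every point between it and xbar to xbar.  If the
   points of the ray move away from xbar, a point x of an open quadrant is
   separated from xbar by one of them, whose orbit pushes that of x out of I and,
   being monotone, prevents it from coming back. *)
Require Import Defs.
From mathcomp Require Import lra ring.
Set Implicit Arguments.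
Unset Strict Implicit.
Unset Printing Implicit Defensive.
Import Order.TTheory GRing.Theory Num.Theory numFieldNormedType.Exports.
Local Open Scope classical_set_scope.
Local Open Scope ring_scope.

(** * Neighborhoods as intervals and boxes *)

Lemma near0P (R : realType) (P : R -> Prop) :
  (\forall t \near (0 : R), P t) <->
  exists2 r : R, 0 < r & forall t, `|t| < r -> P t.
Proof.
split.
  move=> /nbhs_ballP[r /= r0 H]; exists r => // t tr.
  by apply: H; rewrite -ball_normE /= sub0r normrN.
move=> [r r0 H]; apply/nbhs_ballP; exists r => //= t.
by rewrite -ball_normE /= sub0r normrN; exact: H.
Qed.

Lemma near_boxP (R : realType) (p : R * R) (P : R * R -> Prop) :
  (\forall z \near p, P z) <->
  exists2 e : R, 0 < e &
    forall z, `|z.1 - p.1| < e -> `|z.2 - p.2| < e -> P z.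
Proof.
split.
  move=> /nbhs_ballP[e /= e0 H]; exists e => // z z1 z2.
  by apply: H; split; rewrite -ball_normE /= distrC.
move=> [e e0 H]; apply/nbhs_ballP; exists e => //= z [].
by rewrite -!ball_normE /= => z1 z2; apply: H; rewrite distrC.
Qed.

(** * Power series in one variable: leading term and sign near 0 *)

Lemma norm_lim_le (R : realType) (u : nat -> R) (a B : R) :
  u @ \oo --> a -> (\forall n \near \oo, `|u n| <= B) -> `|a| <= B.
Proof.
move=> /cvg_norm ua uB.
exact: (@closed_cvg _ _ _ _ _ [set x | x <= B] (@closed_le _ B) uB _ ua).
Qed.

(** Subtracting [q ^+ n] makes the bound inductive: the new term is at most [M * q ^+ n], and this
    is at most [2 * M * (q ^+ n - q ^+ n.+1)] because [q] is at most 1/2. *)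
Lemma geometric_tail (R : realType) (a : nat -> R) (M q : R) (l n : nat) :
    0 <= q -> 2 * q <= 1 -> 0 <= M ->
    (forall j, (l <= j)%N -> `|a j| <= M * q ^+ j) -> (l <= n)%N ->
  `|\sum_(l <= j < n) a j| <= 2 * M * (q ^+ l - q ^+ n).
Proof.
move=> q0 q1 M0 aM; elim: n => [|n IH].
  rewrite leqn0 => /eqP ->; rewrite big_geq // normr0 subrr mulr0 //.
rewrite leq_eqVlt => /orP[/eqP ->|]; first by rewrite big_geq // normr0 subrr mulr0.
rewrite ltnS => ln; rewrite big_nat_recr //=.
apply: le_trans (ler_normD _ _) _.
apply: le_trans (lerD (IH ln) (aM n ln)) _.
have qn0 : 0 <= M * q ^+ n by rewrite mulr_ge0 // exprn_ge0.
rewrite exprS; nra.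
Qed.

(** Convergence at a single [t0 > 0] bounds all the terms [a j * t0 ^+ j]. For [t] below [t0 / 2]
    the terms after the [l]-th are then dominated by a geometric series of ratio at most 1/2. *)
Lemma pseries_leading_term (R : realType) (a : nat -> R) (e : R -> R) (l : nat) :
    (2 <= l)%N ->
    (\forall t \near (0 : R),
      (fun n => \sum_(2 <= j < n) t ^+ j * a j) @ \oo --> e t) ->
    (forall j, (2 <= j)%N -> (j < l)%N -> a j = 0) ->
  exists2 K : R, 0 <= K &
    \forall t \near (0 : R), `|e t - t ^+ l * a l| <= K * `|t| ^+ l.+1.
Proof.
move=> l2 /near0P[r r0 H] al.
pose t0 := r / 2; have t00 : 0 < t0 by rewrite /t0; lra.
have t0r : `|t0| < r by rewrite gtr0_norm // /t0; lra.
have /cvgP/cvg_seq_bounded[B0 [_ bnd]] := H _ t0r.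
(* Boundedness of the partial sums provides every number strictly above [B0] as a bound, hence
   [B0 + 1]. *)
pose B := Num.max 0 (B0 + 1).
have B_ge0 : 0 <= B by rewrite /B le_max lexx.
have partB n : `|\sum_(2 <= j < n) t0 ^+ j * a j| <= B.
  apply: le_trans (bnd (B0 + 1) _ n I) _; first by lra.
  by rewrite /B le_max lexx orbT.
have termB j : (2 <= j)%N -> `|a j| * t0 ^+ j <= 2 * B.
  move=> j2.
  (* A term is the difference of two consecutive partial sums, each bounded by [B]. *)
  have -> : `|a j| * t0 ^+ j =
     `|\sum_(2 <= i < j.+1) t0 ^+ i * a i - \sum_(2 <= i < j) t0 ^+ i * a i|.
    rewrite big_nat_recr //= [X in X - _]addrC addrK normrM mulrC; congr (_ * _).
    by rewrite ger0_norm // exprn_ge0 // ltW.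
  have := ler_normB (\sum_(2 <= i < j.+1) t0 ^+ i * a i)
                    (\sum_(2 <= i < j) t0 ^+ i * a i).
  have := partB j; have := partB j.+1; lra.
exists (4 * B / t0 ^+ l.+1); first by rewrite divr_ge0 ?exprn_ge0 ?mulr_ge0 // ltW.
apply/near0P; exists (t0 / 2) => [|t tt0]; first by lra.
have tr : `|t| < r by rewrite gtr0_norm // in t0r; lra.
clearbody t0.
pose q := `|t| / t0.
have q0 : 0 <= q by rewrite divr_ge0 // ltW.
have q1 : 2 * q <= 1 by rewrite /q mulrA ler_pdivrMr // mul1r; lra.
apply: norm_lim_le (cvgB (H _ tr) (cvg_cst (t ^+ l * a l))) _; exists l.+1 => // n /= ln.
(* Cut the sum after the index [l]: the terms below [l] vanish, the [l]-th one cancels the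
   subtracted term, and only the tail from [l.+1] remains. *)
rewrite /= !fctE (big_cat_nat (leqW l2) ln) /=.
rewrite big_nat_recr //= big_nat big1 ?add0r => [|j /andP[j2 jl]]; last first.
  by rewrite al ?mulr0.
rewrite [X in `|X|](_ : _ = \sum_(l.+1 <= j < n) t ^+ j * a j); last by ring.
apply: (@le_trans _ _ (2 * (2 * B) * (q ^+ l.+1 - q ^+ n))).
  apply: geometric_tail => //; first by lra.
  move=> j lj; rewrite normrM normrX /q expr_div_n mulrA.
  rewrite ler_pdivlMr ?exprn_gt0 // -mulrA [leRHS]mulrC.
  by rewrite ler_wpM2l ?exprn_ge0 // termB // (leq_trans l2) // ltnW.
have -> : 4 * B / t0 ^+ l.+1 * `|t| ^+ l.+1 = 4 * B * q ^+ l.+1.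
  by rewrite /q expr_div_n; ring.
have : 0 <= q ^+ n by rewrite exprn_ge0.
nra.
Qed.

Lemma pseries_sign (R : realType) (a : nat -> R) (e : R -> R) (l : nat) :
    (2 <= l)%N ->
    (\forall t \near (0 : R),
      (fun n => \sum_(2 <= j < n) t ^+ j * a j) @ \oo --> e t) ->
    (forall j, (2 <= j)%N -> (j < l)%N -> a j = 0) -> a l != 0 ->
  \forall t \near (0 : R),
    (0 <= t ^+ l * a l -> 0 <= e t) /\ (t ^+ l * a l <= 0 -> e t <= 0).
Proof.
move=> l2 ea al al0.
have [K K0 /near0P[r r0 H]] := pseries_leading_term l2 ea al.
have A0 : 0 < `|a l| by rewrite normr_gt0.
(* Below this radius the error [K * |t| ^+ l.+1] is at most [|t ^+ l * a l|], so it cannot reverse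
   the sign; [K + 1] avoids dividing by zero when [K = 0]. *)
apply/near0P; exists (Num.min r (`|a l| / (K + 1))).
  by rewrite lt_min r0 divr_gt0 //; lra.
move=> t; rewrite lt_min => /andP[tr]; rewrite ltr_pdivlMr ?ltr_wpDl // => tK.
have : `|e t - t ^+ l * a l| <= `|t ^+ l * a l|.
  apply: le_trans (H t tr) _.
  rewrite normrM normrX exprSr mulrCA ler_wpM2l ?exprn_ge0 //.
  have := normr_ge0 t; nra.
move=> Het; split=> s; move: Het.
  by rewrite (ger0_norm s) ler_norml => /andP[]; lra.
by rewrite (ler0_norm s) ler_norml => /andP[]; lra.
Qed.

(** A series that starts at order 2 is [O(t ^ 2)], which for an affine function forces both
    coefficients to vanish. *)
Lemma pseries_affine0 (R : realType) (a : nat -> R) (e : R -> R) :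
    (\forall t \near (0 : R),
      (fun n => \sum_(2 <= j < n) t ^+ j * a j) @ \oo --> e t) ->
    (exists P Q, \forall t \near (0 : R), e t = P + Q * t) ->
  \forall t \near (0 : R), e t = 0.
Proof.
move=> ea [P [Q aff]].
have a2 j : (2 <= j)%N -> (j < 2)%N -> a j = 0 by case: j => [|[]].
have [K K0 near_e] := pseries_leading_term (leqnn 2) ea a2.
have /near0P[r r0 H] : \forall t \near (0 : R),
    e t = P + Q * t /\ `|e t - t ^+ 2 * a 2| <= K * `|t| ^+ 3.
  by near=> t; split; near: t.
have P0 : P = 0.
  have [e0] := H 0 ltac:(by rewrite normr0).
  rewrite e0 mulr0 addr0 normr0 !expr0n /= mul0r subr0 mulr0 normr_le0.
  by move/eqP.
have Q0 : Q = 0.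
  apply/eqP/negP => /negP Q0; have A0 : 0 < `|Q| by rewrite normr_gt0.
  pose C := K + `|a 2| + 1; have C0 : 0 < C by rewrite /C ltr_wpDl // addr_ge0.
  (* With [t <= 1] and [t * C <= |Q|], dividing the order 2 estimate by [t] gives [|Q| <= t * (K * t
     + |a 2|) < t * C <= |Q|], a contradiction. *)
  pose t := Num.min (Num.min (r / 2) 1) (`|Q| / C).
  have t_gt0 : 0 < t by rewrite /t !lt_min ltr01 divr_gt0 // divr_gt0.
  have t_r : t < r.
    apply: (@le_lt_trans _ _ (r / 2)); last lra.
    by rewrite /t !ge_min lexx.
  have t_1 : t <= 1 by rewrite /t !ge_min lexx orbT.
  have t_Q : t * C <= `|Q| by rewrite -ler_pdivlMr // /t !ge_min lexx !orbT.
  have [] := H t; first by rewrite gtr0_norm.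
  rewrite P0 add0r => -> h.
  have : `|Q * t| <= K * t ^+ 3 + t ^+ 2 * `|a 2|.
    rewrite -[Q * t](subrK (t ^+ 2 * a 2)); apply: le_trans (ler_normD _ _) _.
    by rewrite [`|t|]gtr0_norm // in h; rewrite lerD // normrM normrX gtr0_norm.
  rewrite normrM [`|t|]gtr0_norm //.
  have -> : K * t ^+ 3 + t ^+ 2 * `|a 2| = (t * (K * t + `|a 2|)) * t by ring.
  rewrite ler_pM2r // leNgt => /negP; apply; apply: lt_le_trans t_Q.
  rewrite ltr_pM2l // /C -addrA ler_ltD //; last by lra.
  nra.
apply/near0P; exists r => // t /H[-> _]; rewrite P0 Q0; ring.
Unshelve. all: by end_near.
Qed.

(** * The South-East order and limits of sequences *)

Lemma se_le_refl (R : realType) (z : R * R) : se_le z z.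
Proof. by split. Qed.

Lemma se_le_trans (R : realType) (y x z : R * R) :
  se_le x y -> se_le y z -> se_le x z.
Proof.
by move=> [xy1 xy2] [yz1 yz2]; split; [exact: le_trans yz1|exact: le_trans xy2].
Qed.

Lemma se_le_anti (R : realType) (x y : R * R) : se_le x y -> se_le y x -> x = y.
Proof.
case: x y => [x1 x2] [y1 y2] [/= h1 h2] [/= h3 h4].
by congr pair; apply: le_anti; rewrite ?h1 ?h2 ?h3 ?h4.
Qed.

Lemma cvg_pairP (R : realType) (u : nat -> R * R) (p : R * R) :
  u @ \oo --> p <->
  (fun n => (u n).1) @ \oo --> p.1 /\ (fun n => (u n).2) @ \oo --> p.2.
Proof.
case: p => p1 p2; split => [up|[u1 u2]]; last first.
  rewrite (_ : u = fun n => ((u n).1, (u n).2)); first exact: cvg_pair u1 u2.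
  by apply/funext => n; case: (u n).
by split; apply: cvg_comp up _; [exact: cvg_fst|exact: cvg_snd].
Qed.

Lemma cvg_ge_cst (R : realType) (u : nat -> R) (a p : R) :
  u @ \oo --> p -> (forall n, a <= u n) -> a <= p.
Proof.
move=> up au; have := @closed_cvg _ _ _ _ u [set x | a <= x] (@closed_ge _ a) _ _ up.
by apply; exact: nearW.
Qed.

Lemma cvg_le_cst (R : realType) (u : nat -> R) (b p : R) :
  u @ \oo --> p -> (forall n, u n <= b) -> p <= b.
Proof.
move=> up ub; have := @closed_cvg _ _ _ _ u [set x | x <= b] (@closed_le _ b) _ _ up.
by apply; exact: nearW.
Qed.

Lemma se_le_lim (R : realType) (u : nat -> R * R) (a b p : R * R) :
    u @ \oo --> p ->
  ((forall n, se_le a (u n)) -> se_le a p) /\ ((forall n, se_le (u n) b) -> se_le p b).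
Proof.
move=> /cvg_pairP[u1 u2]; split=> H; split.
- by apply: cvg_ge_cst u1 _ => n; case: (H n).
- by apply: cvg_le_cst u2 _ => n; case: (H n).
- by apply: cvg_le_cst u1 _ => n; case: (H n).
- by apply: cvg_ge_cst u2 _ => n; case: (H n).
Qed.

Lemma se_squeeze (R : realType) (u x w : nat -> R * R) (p : R * R) :
    (forall n, se_le (u n) (x n) /\ se_le (x n) (w n)) ->
  u @ \oo --> p -> w @ \oo --> p -> x @ \oo --> p.
Proof.
move=> H /cvg_pairP[u1 u2] /cvg_pairP[w1 w2]; apply/cvg_pairP; split.
  by apply: squeeze_cvgr u1 w1; apply: nearW => n; case: (H n) => -[-> _] [-> _].
by apply: squeeze_cvgr w2 u2; apply: nearW => n; case: (H n) => -[_ ->] [_ ->].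
Qed.

Lemma monotone_bounded_cvg (R : realType) (u : nat -> R) (a b : R) :
    (forall n, a <= u n <= b) ->
    (forall n, u n <= u n.+1) \/ (forall n, u n.+1 <= u n) ->
  exists q : R, u @ \oo --> q.
Proof.
move=> ab [/nondecreasing_seqP mon|/nonincreasing_seqP mon].
  exists (sup (range u)); apply: nondecreasing_cvgn => //.
  by exists b => _ [n _ <-]; case/andP: (ab n).
exists (inf (range u)); apply: nonincreasing_cvgn => //.
by exists a => _ [n _ <-]; case/andP: (ab n).
Qed.

(** * Orbits of competitive maps: convergence and escape *)

(** Pass from [z = (x, y)] to [w = (s, t)] through the corner [(s, y)], which lies in [D] because
    [D] is a product; each leg changes one variable only. *)
Lemma competitive_se_le (R : realType) (D : set (R * R)) (T : R * R -> R * R)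
    (z w : R * R) :
    rectangular D -> competitive D T -> D z -> D w -> se_le z w ->
  se_le (T z) (T w).
Proof.
move=> [A [B [_ _ ->]]] [Tx Ty].
case: z w => [x y] [s t] [/= Ax By] [/= As Bt] [/= xs ty].
have [|//||h1 h2] := Tx x s y => //.
have [|//||h3 h4] := Ty s t y => //.
by split; [exact: le_trans h3|exact: le_trans h2].
Qed.

(** The interval is closed, so an orbit converging inside it has its limit there, and a limit that
    is a fixed point can only be [p]. *)
Definition isolating_interval (R : realType) (D : set (R * R))
    (T : R * R -> R * R) (p a b : R * R) : Prop :=
  [/\ se_le a p, se_le p b, T p = p &
      forall z, se_le a z -> se_le z b -> D z /\ (T z = z -> z = p)].

Lemma iter_map_on (R : realType) (D : set (R * R)) (T : R * R -> R * R)
    (z : R * R) (n : nat) :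
  map_on D T -> D z -> D (iter n T z).
Proof. by move=> [_ TD] Dz; elim: n => //= n /TD. Qed.

Lemma iter_fixed (R : realType) (T : R * R -> R * R) (p : R * R) (n : nat) :
  T p = p -> iter n T p = p.
Proof. by move=> Tp; elim: n => //= n ->. Qed.

Lemma iter_se_le (R : realType) (D : set (R * R)) (T : R * R -> R * R)
    (z w : R * R) (n : nat) :
    rectangular D -> competitive D T -> map_on D T -> D z -> D w -> se_le z w ->
  se_le (iter n T z) (iter n T w).
Proof.
move=> Dr Tc Tm Dz Dw zw; elim: n => //= n IH.
by apply: (competitive_se_le Dr Tc) => //; exact: iter_map_on.
Qed.

(** Order preservation propagates the first comparison between [z] and [T z] along the orbit, so
    both coordinates are monotone and bounded. By continuity the limit is a fixed point. *)
Lemma monotone_orbit_cvg (R : realType) (D : set (R * R)) (T : R * R -> R * R)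
    (p a b z : R * R) :
    rectangular D -> competitive D T -> map_on D T ->
    isolating_interval D T p a b ->
    (forall n, se_le a (iter n T z) /\ se_le (iter n T z) b) ->
    subsolution T z \/ supersolution T z ->
  (fun n => iter n T z) @ \oo --> p.
Proof.
move=> Dr Tc Tm [ap pb _ iso] orb mon.
have Dn n : D (iter n T z) by case: (orb n) => an nb; case: (iso _ an nb).
have Dz : D z := Dn 0.
have TDz : D (T z) := Dn 1.
have stepE n : iter n.+1 T z = iter n T (T z) by rewrite iterSr.
have [q1 uq1] : exists q : R, (fun n => (iter n T z).1) @ \oo --> q.
  apply: (@monotone_bounded_cvg _ _ a.1 b.1) => [n|].
    by have [[-> _] [-> _]] := orb n.
  by case: mon => mon; [right|left] => n; rewrite stepE;
    have [] := iter_se_le n Dr Tc Tm _ _ mon.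
have [q2 uq2] : exists q : R, (fun n => (iter n T z).2) @ \oo --> q.
  apply: (@monotone_bounded_cvg _ _ b.2 a.2) => [n|].
    by have [[_ ->] [_ ->]] := orb n.
  by case: mon => mon; [left|right] => n; rewrite stepE;
    have [] := iter_se_le n Dr Tc Tm _ _ mon.
have uq : (fun n => iter n T z) @ \oo --> (q1, q2) by apply/cvg_pairP.
have [Lq Rq] := se_le_lim a b uq.
have [Dq] := iso _ (Lq (fun n => (orb n).1)) (Rq (fun n => (orb n).2)).
suff -> : T (q1, q2) = (q1, q2) by move=> /(_ erefl) <-.
(* [T] is continuous only relative to [D], so the convergence has to be restricted to [D], where the
   whole orbit lies. *)
have uqD : (fun n => iter n T z) @ \oo --> within D (nbhs (q1, q2)).
  move=> P PD; by apply: (@filterS _ \oo _ _ _ _ (uq _ PD)) => n /= /(_ (Dn n)).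
have Tuq : (fun n => iter n.+1 T z) @ \oo --> T (q1, q2) :=
  cvg_comp _ _ uqD ((subspace_continuousP _ _).1 Tm.1 _ Dq).
have Suq : (fun n => iter n.+1 T z) @ \oo --> (q1, q2).
  apply/cvg_pairP; split.
    by rewrite (cvg_shiftS (fun n => (iter n T z).1)).
  by rewrite (cvg_shiftS (fun n => (iter n T z).2)).
exact: norm_cvg_unique Tuq Suq.
Qed.

(* Applied with [le] equal to [se_le] and to its converse, so as to cover the
   fourth and the second quadrant at once. *)
Lemma orbit_escape (R : realType) (D I : set (R * R)) (T : R * R -> R * R)
    (le : R * R -> R * R -> Prop) (p b z x : R * R) :
    (forall u, le u u) -> (forall u v w, le u v -> le v w -> le u w) ->
    (forall u v n, D u -> D v -> le u v -> le (iter n T u) (iter n T v)) ->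
    map_on D T -> T p = p -> D p ->
    (forall w, I w -> le w b) ->
    (forall w, le p w -> le w b -> I w) ->
    ((forall n, I (iter n T z)) -> z = p) ->
    D z -> z <> p -> le p z -> le z (T z) -> D x -> le z x ->
  exists N : nat, forall n, (N <= n)%N -> ~ I (iter n T x).
Proof.
move=> lerefl letr mono Tm Tp Dp Ib Ipb trap Dz zp pz zTz Dx zx.
have /existsNP[N outN] : ~ forall n, I (iter n T z) by move=> /trap.
(* If [T^n x] were in [I] for some [n >= N], the chain [p <= T^N z <= T^n z <= T^n x <= b] in the
   order [le] would put [T^N z] back in [I]. *)
exists N => n Nn Ix; apply: outN; apply: Ipb.
  by rewrite -(iter_fixed N Tp); exact: mono.
have TDz : D (T z) by have /= := iter_map_on 1 Tm Dz.
have mon k : le (iter N T z) (iter (k + N) T z).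
  elim: k => [|k IH]; first exact: lerefl.
  by apply: (letr _ _ _ IH); rewrite addSn iterSr; exact: mono.
have := mon (n - N)%N; rewrite subnK // => zNn.
exact: letr zNn (letr _ _ _ (mono _ _ _ Dz Dx zx) (Ib _ Ix)).
Qed.

Lemma Q4_escape (R : realType) (D : set (R * R)) (T : R * R -> R * R)
    (p a b z x : R * R) :
    rectangular D -> competitive D T -> map_on D T ->
    isolating_interval D T p a b ->
    se_le p z -> z <> p -> supersolution T z -> se_le z x -> se_le x b ->
  exists N : nat, forall n, (N <= n)%N ->
    ~ (se_le a (iter n T x) /\ se_le (iter n T x) b).
Proof.
move=> Dr Tc Tm iso pz zp zsup zx xb; have [ap pb Tp isoD] := iso.
have Dp : D p by case: (isoD p ap pb).
have Dx : D x by case: (isoD x (se_le_trans ap (se_le_trans pz zx)) xb).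
have Dz : D z by case: (isoD z (se_le_trans ap pz) (se_le_trans zx xb)).
apply: (@orbit_escape R D [set w | se_le a w /\ se_le w b] T (@se_le R) p b z x)
  => //.
- by move=> u v w; exact: se_le_trans.
- by move=> u v n Du Dv; exact: (iter_se_le n Dr Tc Tm).
- by move=> w [].
- by move=> w pw wb; split => //; exact: se_le_trans pw.
(* An orbit of [z] trapped in the interval converges to [p] while staying above [z], so [z] is below
   [p] as well as above it. *)
move=> orb; apply: se_le_anti pz.
have zlim := monotone_orbit_cvg Dr Tc Tm iso orb (or_intror zsup).
apply: (se_le_lim z b zlim).1 => n; elim: n => [|n IH]; first exact: se_le_refl.
apply: se_le_trans IH _; rewrite iterSr.
by apply: (iter_se_le n Dr Tc Tm) => //; case: (orb 1%N) => a1 b1; case: (isoD _ a1 b1).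
Qed.

Lemma Q2_escape (R : realType) (D : set (R * R)) (T : R * R -> R * R)
    (p a b z x : R * R) :
    rectangular D -> competitive D T -> map_on D T ->
    isolating_interval D T p a b ->
    se_le z p -> z <> p -> subsolution T z -> se_le x z -> se_le a x ->
  exists N : nat, forall n, (N <= n)%N ->
    ~ (se_le a (iter n T x) /\ se_le (iter n T x) b).
Proof.
move=> Dr Tc Tm iso zp' zp zsub xz ax; have [ap pb Tp isoD] := iso.
have Dp : D p by case: (isoD p ap pb).
have Dx : D x by case: (isoD x ax (se_le_trans xz (se_le_trans zp' pb))).
have Dz : D z by case: (isoD z (se_le_trans ax xz) (se_le_trans zp' pb)).
apply: (@orbit_escape R D [set w | se_le a w /\ se_le w b] T
  (fun u v => se_le v u) p a z x) => //.
- by move=> u v w vu wv; exact: se_le_trans vu.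
- by move=> u v n Du Dv; exact: (iter_se_le n Dr Tc Tm).
- by move=> w [].
- by move=> w wp aw; split => //; exact: se_le_trans pb.
move=> orb; apply: (se_le_anti zp').
have zlim := monotone_orbit_cvg Dr Tc Tm iso orb (or_introl zsub).
apply: (se_le_lim a z zlim).2 => n; elim: n => [|n IH]; first exact: se_le_refl.
apply: se_le_trans IH; rewrite iterSr.
by apply: (iter_se_le n Dr Tc Tm) => //; case: (orb 1%N) => a1 b1; case: (isoD _ a1 b1).
Qed.

(** The orbit descends from [b] and cannot pass below the fixed point [p], since [T] preserves the
    order; it is thus trapped in the interval. *)
Lemma top_orbit_cvg (R : realType) (D : set (R * R)) (T : R * R -> R * R)
    (p a b : R * R) :
    rectangular D -> competitive D T -> map_on D T ->
    isolating_interval D T p a b -> subsolution T b ->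
  (fun n => iter n T b) @ \oo --> p.
Proof.
move=> Dr Tc Tm iso bsub; have [ap pb Tp isoD] := iso.
have Dp : D p by case: (isoD p ap pb).
have Db : D b by case: (isoD b (se_le_trans ap pb) (se_le_refl b)).
have TDb : D (T b) by exact: (iter_map_on 1 Tm Db).
apply: (monotone_orbit_cvg Dr Tc Tm iso _ (or_introl bsub)) => n; split.
  apply: se_le_trans ap _; rewrite -{1}(iter_fixed n Tp).
  exact: (iter_se_le n Dr Tc Tm).
elim: n => [|n IH]; first exact: se_le_refl.
by apply: se_le_trans IH; rewrite iterSr; exact: (iter_se_le n Dr Tc Tm).
Qed.

Lemma bottom_orbit_cvg (R : realType) (D : set (R * R)) (T : R * R -> R * R)
    (p a b : R * R) :
    rectangular D -> competitive D T -> map_on D T ->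
    isolating_interval D T p a b -> supersolution T a ->
  (fun n => iter n T a) @ \oo --> p.
Proof.
move=> Dr Tc Tm iso asup; have [ap pb Tp isoD] := iso.
have Dp : D p by case: (isoD p ap pb).
have Da : D a by case: (isoD a (se_le_refl a) (se_le_trans ap pb)).
have TDa : D (T a) by exact: (iter_map_on 1 Tm Da).
apply: (monotone_orbit_cvg Dr Tc Tm iso _ (or_intror asup)) => n; split; last first.
  apply: se_le_trans pb; rewrite -{1}(iter_fixed n Tp).
  exact: (iter_se_le n Dr Tc Tm).
elim: n => [|n IH]; first exact: se_le_refl.
by apply: se_le_trans IH _; rewrite iterSr; exact: (iter_se_le n Dr Tc Tm).
Qed.

Lemma orbit_squeeze (R : realType) (D : set (R * R)) (T : R * R -> R * R)
    (p y x z : R * R) :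
    rectangular D -> competitive D T -> map_on D T -> D y -> D x -> D z ->
    se_le y x -> se_le x z ->
    (fun n => iter n T y) @ \oo --> p -> (fun n => iter n T z) @ \oo --> p ->
  (fun n => iter n T x) @ \oo --> p.
Proof.
move=> Dr Tc Tm Dy Dx Dz yx xz; apply: se_squeeze => n.
by split; exact: (iter_se_le n Dr Tc Tm).
Qed.

(** * Open quadrants and rays issuing from the fixed point *)

Lemma near_box_shift (R : realType) (p : R * R) (P : R * R -> Prop) :
    (\forall z \near p, P z) ->
  exists2 e : R, 0 < e &
    forall h k, `|h| < e -> `|k| < e -> P (p.1 + h, p.2 + k).
Proof.
move=> /near_boxP[e e0 H]; exists e => // h k he ke.
by apply: H; rewrite /= addrC addKr.
Qed.

Lemma interior_Q2 (R : realType) (p : R * R) :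
  interior (Q2 p) = [set z | z.1 < p.1 /\ p.2 < z.2].
Proof.
apply/seteqP; split => z /=; last first.
  move=> [h1 h2]; apply/near_boxP; exists (Num.min (p.1 - z.1) (z.2 - p.2)).
    by rewrite lt_min !subr_gt0 h1.
  move=> y; rewrite !lt_min !ltr_norml.
  by move=> /andP[/andP[? ?] _] /andP[_ /andP[? ?]]; split; lra.
move=> /near_box_shift[e e0 /(_ (e / 2) (- (e / 2)))].
have e2 : `|e / 2| < e by rewrite gtr0_norm; lra.
rewrite normrN => /(_ e2 e2).
rewrite /Q2 /= => -[? ?]; split; lra.
Qed.

Lemma interior_Q4 (R : realType) (p : R * R) :
  interior (Q4 p) = [set z | p.1 < z.1 /\ z.2 < p.2].
Proof.
apply/seteqP; split => z /=; last first.
  move=> [h1 h2]; apply/near_boxP; exists (Num.min (z.1 - p.1) (p.2 - z.2)).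
    by rewrite lt_min !subr_gt0 h1.
  move=> y; rewrite !lt_min !ltr_norml.
  by move=> /andP[/andP[? ?] _] /andP[_ /andP[? ?]]; split; lra.
move=> /near_box_shift[e e0 /(_ (- (e / 2)) (e / 2))].
have e2 : `|e / 2| < e by rewrite gtr0_norm; lra.
rewrite normrN => /(_ e2 e2).
rewrite /Q4 /= => -[? ?]; split; lra.
Qed.

(** Shift an interior point by [e / 2] both ways along the diagonal. The two shifts cannot land in
    different quadrants, and landing in the same one makes its inequalities strict at the point. *)
Lemma interior_Q2U4 (R : realType) (p : R * R) :
  interior (Q2 p `|` Q4 p) `<=` interior (Q2 p) `|` interior (Q4 p).
Proof.
rewrite interior_Q2 interior_Q4 => z /near_box_shift[e e0 H].
have e2 : `|e / 2| < e by rewrite gtr0_norm; lra.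
have := H (e / 2) (e / 2); have := H (- (e / 2)) (- (e / 2)).
rewrite normrN => /(_ e2 e2) + /(_ e2 e2).
rewrite /Q2 /Q4 /= => -[[? ?]|[? ?]] [[? ?]|[? ?]]; (left; lra) || (right; lra) || lra.
Qed.

Lemma near_ray (R : realType) (p w : R * R) (P : R * R -> Prop) :
    (\forall z \near p, P z) ->
  exists2 r : R, 0 < r & forall t, `|t| < r -> P (p + t *: w).
Proof.
move=> /near_box_shift[e e0 H].
have C0 : 0 < `|w.1| + `|w.2| + 1 by rewrite ltr_wpDl // addr_ge0.
(* The denominator dominates both coordinates of [w], and the added 1 keeps it positive when
   [w = 0]. *)
exists (e / (`|w.1| + `|w.2| + 1)); first exact: divr_gt0.
move=> t; rewrite ltr_pdivlMr // => te.
have [t0 w10 w20] := And3 (normr_ge0 t) (normr_ge0 w.1) (normr_ge0 w.2).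
apply: (H (t * w.1) (t * w.2)); rewrite normrM; nra.
Qed.

Lemma ray_signs (R : realType) (w : R * R) (s : R) :
  w.1 < 0 -> 0 < w.2 -> 0 < s -> s *: w.1 < 0 /\ 0 < s *: w.2.
Proof.
by move=> w1 w2 s0; rewrite /GRing.scale /=; split; nra.
Qed.

(** Since [p] is interior to the second quadrant of [x], the points [p - s *: w] with small [s] lie
    strictly above [p] and still below [x]; such a supersolution separates [x] from [p]. *)
Lemma Q4_ray_escape (R : realType) (D : set (R * R)) (T : R * R -> R * R)
    (p a b w x : R * R) (r : R) :
    rectangular D -> competitive D T -> map_on D T ->
    isolating_interval D T p a b -> w.1 < 0 -> 0 < w.2 -> 0 < r ->
    (forall s, 0 < s < r -> supersolution T (p - s *: w)) ->
    se_le x b -> interior (Q4 p) x ->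
  exists N : nat, forall n, (N <= n)%N ->
    ~ (se_le a (iter n T x) /\ se_le (iter n T x) b).
Proof.
move=> Dr Tc Tm iso w1 w2 r0 sup xb xint.
have : interior (Q2 x) p by rewrite interior_Q4 in xint; rewrite interior_Q2.
move=> /(near_ray (- w))[q q0 H].
pose s := Num.min q r / 2.
have m0 : 0 < Num.min q r by rewrite lt_min q0.
have [mq mr] : Num.min q r <= q /\ Num.min q r <= r by rewrite !ge_min !lexx orbT.
have s0 : 0 < s by rewrite /s; lra.
have sq : s < q by rewrite /s; lra.
have sr : s < r by rewrite /s; lra.
have [sw1 sw2] := ray_signs w1 w2 s0.
apply: (Q4_escape (z := p - s *: w) Dr Tc Tm iso) => //.
- by split => /=; lra.
- by move/(congr1 fst) => /=; lra.
- by apply: sup; rewrite s0.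
- by rewrite -scalerN; apply: H; rewrite gtr0_norm.
Qed.

Lemma Q2_ray_escape (R : realType) (D : set (R * R)) (T : R * R -> R * R)
    (p a b w x : R * R) (r : R) :
    rectangular D -> competitive D T -> map_on D T ->
    isolating_interval D T p a b -> w.1 < 0 -> 0 < w.2 -> 0 < r ->
    (forall s, 0 < s < r -> subsolution T (p + s *: w)) ->
    se_le a x -> interior (Q2 p) x ->
  exists N : nat, forall n, (N <= n)%N ->
    ~ (se_le a (iter n T x) /\ se_le (iter n T x) b).
Proof.
move=> Dr Tc Tm iso w1 w2 r0 sub ax xint.
have : interior (Q4 x) p by rewrite interior_Q2 in xint; rewrite interior_Q4.
move=> /(near_ray w)[q q0 H].
pose s := Num.min q r / 2.
have m0 : 0 < Num.min q r by rewrite lt_min q0.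
have [mq mr] : Num.min q r <= q /\ Num.min q r <= r by rewrite !ge_min !lexx orbT.
have s0 : 0 < s by rewrite /s; lra.
have sq : s < q by rewrite /s; lra.
have sr : s < r by rewrite /s; lra.
have [sw1 sw2] := ray_signs w1 w2 s0.
apply: (Q2_escape (z := p + s *: w) Dr Tc Tm iso) => //.
- by split => /=; lra.
- by move/(congr1 fst) => /=; lra.
- by apply: sub; rewrite s0.
- by apply: H; rewrite gtr0_norm.
Qed.

(** * Taylor expansion along the eigendirection: subsolutions and supersolutions *)

Lemma taylor_components (R : realType) (T : R * R -> R * R) (p v : R * R)
    (c d : nat -> R) :
    taylor_along T p v c d ->
  (\forall t \near (0 : R), (fun n => \sum_(2 <= j < n) t ^+ j * c j) @ \oo -->
     (T (p + t *: v)).1 - (p.1 + t * v.1)) /\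
  (\forall t \near (0 : R), (fun n => \sum_(2 <= j < n) t ^+ j * d j) @ \oo -->
     (T (p + t *: v)).2 - (p.2 + t * v.2)).
Proof.
move=> /near0P[r r0 H]; split; apply/near0P; exists r => // t /H /cvg_pairP[T1 T2].
  have -> : (fun n => \sum_(2 <= j < n) t ^+ j * c j) =
      (fun n => (p + t *: v + \sum_(2 <= j < n) t ^+ j *: (c j, d j)).1 -
                (p.1 + t * v.1)).
    apply/funext => n /=; rewrite (big_morph fst (id1 := 0) (op1 := +%R)) //=.
    by rewrite [RHS]addrC addKr.
  exact: cvgB T1 (cvg_cst _).
have -> : (fun n => \sum_(2 <= j < n) t ^+ j * d j) =
    (fun n => (p + t *: v + \sum_(2 <= j < n) t ^+ j *: (c j, d j)).2 -
              (p.2 + t * v.2)).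
  apply/funext => n /=; rewrite (big_morph snd (id1 := 0) (op1 := +%R)) //=.
  by rewrite [RHS]addrC addKr.
exact: cvgB T2 (cvg_cst _).
Qed.

(** A nonzero [a l] decides the sign of the remainder. If [h] is affine, the remainder vanishes near
    0 and both inequalities hold as equalities. *)
Lemma component_sign (R : realType) (a : nat -> R) (h : R -> R) (x y : R) (l : nat) :
    (2 <= l)%N ->
    (\forall t \near (0 : R),
      (fun n => \sum_(2 <= j < n) t ^+ j * a j) @ \oo --> h t - (x + t * y)) ->
    (forall j, (2 <= j)%N -> (j < l)%N -> a j = 0) ->
    a l != 0 \/ affine_near0 h ->
  \forall t \near (0 : R),
    (0 <= t ^+ l * a l -> x + t * y <= h t) /\
    (t ^+ l * a l <= 0 -> h t <= x + t * y).
Proof.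
move=> l2 ha al [al0|[P [Q hPQ]]].
  have := pseries_sign l2 ha al al0; apply: filterS => t [pos neg].
  by split=> [/pos|/neg]; rewrite ?subr_ge0 ?subr_le0.
have aff : exists P Q, \forall t \near (0 : R), h t - (x + t * y) = P + Q * t.
  exists (P - x), (Q - y); apply: filterS hPQ => t ->; ring.
have := pseries_affine0 ha aff; apply: filterS => t /subr0_eq ->.
by split.
Qed.

Lemma ray_comparison (R : realType) (T : R * R -> R * R) (p v : R * R)
    (c d : nat -> R) (l : nat) :
    taylor_along T p v c d -> (2 <= l)%N ->
    (forall j, (2 <= j)%N -> (j < l)%N -> (c j, d j) = (0, 0)) ->
    c l != 0 \/ affine_near0 (fun t => (T (p + t *: v)).1) ->
    d l != 0 \/ affine_near0 (fun t => (T (p + t *: v)).2) ->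
  exists2 r : R, 0 < r & forall t, `|t| < r ->
    (se_le (t ^+ l *: (c l, d l)) 0 -> subsolution T (p + t *: v)) /\
    (se_le 0 (t ^+ l *: (c l, d l)) -> supersolution T (p + t *: v)).
Proof.
move=> /taylor_components[T1 T2] l2 lmin c0 d0; apply/near0P.
have cj j : (2 <= j)%N -> (j < l)%N -> c j = 0 by move=> h1 h2; case: (lmin j h1 h2).
have dj j : (2 <= j)%N -> (j < l)%N -> d j = 0 by move=> h1 h2; case: (lmin j h1 h2).
have := component_sign l2 T1 cj c0; have := component_sign l2 T2 dj d0.
apply: filterS2 => t [d1 d2] [c1 c2].
split=> -[h1 h2].
  by split; [exact: c2|exact: d1].
by split; [exact: c1|exact: d2].
Qed.

Lemma scale_oppX (R : realType) (s : R) (l : nat) (X : R * R) :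
  (- s) ^+ l *: X = s ^+ l *: (if odd l then - X else X).
Proof.
rewrite exprNn -signr_odd; case: odd; rewrite ?expr1 ?expr0 ?mul1r //.
by rewrite mulN1r scaleNr scalerN.
Qed.

Lemma se_le_scale (R : realType) (k : R) (X : R * R) : 0 < k ->
  (se_le X 0 -> se_le (k *: X) 0) /\ (se_le 0 X -> se_le 0 (k *: X)).
Proof.
move=> k0; split=> -[/= h1 h2]; split => /=.
- by rewrite pmulr_rle0.
- by rewrite pmulr_rge0.
- by rewrite pmulr_rge0.
- by rewrite pmulr_rle0.
Qed.

Lemma se_le_opp (R : realType) (z w : R * R) : se_le z w -> se_le (- w) (- z).
Proof. by move=> [h1 h2]; split; rewrite /= lerN2. Qed.

(** At the parameters of [p + s *: w] and [p - s *: w] the term [t ^+ l *: X] equals [s ^+ l *: Y]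
    and [s ^+ l *: Z]: an odd power changes sign across [p], an even one does not. The positive
    factor [s ^+ l] does not affect the comparison with 0. *)
Lemma two_sided_ray (R : realType) (T : R * R -> R * R) (p v X : R * R)
    (l : nat) (r : R) :
    (forall t, `|t| < r ->
      (se_le (t ^+ l *: X) 0 -> subsolution T (p + t *: v)) /\
      (se_le 0 (t ^+ l *: X) -> supersolution T (p + t *: v))) ->
  let w := if v.1 < 0 then v else - v in
  let Y := if odd l then orient v X else X in
  let Z := if odd l then - Y else Y in
  forall s, 0 < s < r ->
  [/\ se_le Y 0 -> subsolution T (p + s *: w),
      se_le 0 Y -> supersolution T (p + s *: w),
      se_le Z 0 -> subsolution T (p - s *: w) &
      se_le 0 Z -> supersolution T (p - s *: w)].
Proof.
move=> H w Y Z s /andP[s0 sr].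
have [] := H s; first by rewrite gtr0_norm.
have [] := H (- s); first by rewrite normrN gtr0_norm.
rewrite scale_oppX scaleNr /Z /Y /w /orient.
case: (v.1 < 0); case: (odd l); rewrite ?scalerN ?opprK => subN supN subP supP;
  split => h; (apply: subN || apply: subP || apply: supN || apply: supP);
  move: h; rewrite ?scalerN -?scalerN;
  by [apply: (se_le_scale _ _).1; rewrite exprn_gt0
     |apply: (se_le_scale _ _).2; rewrite exprn_gt0].
Qed.

(** * The order interval and the witnesses in its neighborhoods *)

(** Endpoints on the line along [w] are within reach of the sign analysis on the ray; as neither
    coordinate of [w] is zero, the interval they span is a neighborhood of [p]. *)
Lemma isolating_interval_along (R : realType) (D : set (R * R))
    (T : R * R -> R * R) (p w : R * R) (r : R) :
    isolated_fixed_point D T p -> (\forall z \near p, D z) ->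
    w.1 < 0 -> 0 < w.2 -> 0 < r ->
  exists s : R, [/\ 0 < s < r, isolating_interval D T p (p + s *: w) (p - s *: w) &
    \forall z \near p, se_le (p + s *: w) z /\ se_le z (p - s *: w)].
Proof.
move=> [Dp Tp isoT] nD w1 w2 r0.
have /near_boxP[e e0 H] : \forall z \near p, D z /\ (T z = z -> z = p).
  by apply: filterS2 nD isoT => z Dz h; split => // /h; exact.
have C0 : 0 < w.2 - w.1 by lra.
(* [w.2 - w.1] is the sum of the absolute values of the coordinates of [w], so half of [m] keeps the
   whole interval within the box of radius [e] around [p]. *)
pose m := Num.min r (e / (w.2 - w.1)).
have m0 : 0 < m by rewrite lt_min r0 divr_gt0.
have [mr] : m <= r /\ m <= e / (w.2 - w.1) by rewrite !ge_min !lexx orbT.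
rewrite ler_pdivlMr // => me.
exists (m / 2); set s := m / 2; have s0 : 0 < s by rewrite /s; lra.
have : s * (w.2 - w.1) < e by rewrite /s; nra.
rewrite mulrBr -![s * _]/(s *: _) => se.
have [sw1 sw2] := ray_signs w1 w2 s0.
split.
- by rewrite s0 /s; lra.
- split => //; [by split => /=; lra..|].
  move=> z [/= h1 h2] [/= h3 h4]; apply: H; rewrite ltr_norml; apply/andP; split; lra.
apply/near_boxP; exists (Num.min (- (s *: w.1)) (s *: w.2)).
  by rewrite lt_min oppr_gt0 sw1.
move=> z; rewrite !lt_min !ltr_norml.
move=> /andP[/andP[z1 z2] _] /andP[_ /andP[z3 z4]].
by split; split => /=; lra.
Qed.

Lemma ray_witnesses (R : realType) (p w : R * R) (U : set (R * R)) (r : R) :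
    (\forall z \near p, U z) -> w.1 < 0 -> 0 < w.2 -> 0 < r ->
  exists s : R, [/\ 0 < s < r, (U `&` interior (Q2 p)) (p + s *: w) &
    (U `&` interior (Q4 p)) (p - s *: w)].
Proof.
move=> /(near_ray w)[q q0 H] w1 w2 r0.
have m0 : 0 < Num.min q r by rewrite lt_min q0.
have [mq mr] : Num.min q r <= q /\ Num.min q r <= r by rewrite !ge_min !lexx orbT.
exists (Num.min q r / 2); set s := _ / 2.
have s0 : 0 < s by rewrite /s; lra.
have sq : s < q by rewrite /s; lra.
have [sw1 sw2] := ray_signs w1 w2 s0.
split; first by rewrite s0 /s; lra.
- split; first by apply: H; rewrite gtr0_norm.
  by rewrite interior_Q2 /=; split; lra.
- split; first by rewrite -scaleNr; apply: H; rewrite normrN gtr0_norm.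
  by rewrite interior_Q4 /=; split; lra.
Qed.

(** * The four cases, by the parity of [l] and the sign of the leading coefficient *)

Theorem theorem7 (R : realType) (D : set (R * R)) (T S : R * R -> R * R)
    (xbar v : R * R) (mu : R) (c d : nat -> R) (l : nat)
    (D_rect : rectangular D) (T_map : map_on D T) (T_comp : competitive D T)
    (xbar_fix : isolated_fixed_point D T xbar)
    (D_int : D `&` interior (Q2 xbar `|` Q4 xbar) !=set0)
    (S_ext : C1_extension D T S xbar)
    (v_eigen : v != 0 /\ 'd S xbar v = mu *: v)
    (v_neg : v.1 * v.2 < 0)
    (T_analytic : real_analytic_at D T xbar)
    (mu1 : mu = 1)
    (T_taylor : taylor_along T xbar v c d)
    (l_ge2 : (2 <= l)%N)
    (l_neq0 : (c l, d l) <> (0, 0))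
    (l_min : forall j : nat, (2 <= j)%N -> (j < l)%N -> (c j, d j) = (0, 0))
    (habc : [\/ c l * d l < 0,
                c l <> 0 /\ affine_near0 (fun t => (T (xbar + t *: v)).2)
              | d l <> 0 /\ affine_near0 (fun t => (T (xbar + t *: v)).1)]) :
  exists I : set (R * R),
    [/\ order_interval I, relative_nbhs D xbar I &
    forall U : set (R * R), relative_nbhs D xbar U -> U `<=` I ->
    [/\
      (* (i) *)
      odd l -> se_le (orient v (c l, d l)) (0, 0) ->
      [/\ exists2 z, (U `&` interior (Q4 xbar)) z & supersolution T z,
          exists2 z, (U `&` interior (Q2 xbar)) z & subsolution T z &
          forall x, (I `&` interior (Q2 xbar `|` Q4 xbar)) x ->
            exists N : nat, forall n, (N <= n)%N -> ~ I (iter n T x)],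
      (* (ii) *)
      odd l -> se_le (0, 0) (orient v (c l, d l)) ->
      [/\ exists2 z, (U `&` interior (Q4 xbar)) z & subsolution T z,
          exists2 z, (U `&` interior (Q2 xbar)) z & supersolution T z &
          forall x, I x -> (fun n => iter n T x) @ \oo --> xbar],
      (* (iii) *)
      ~~ odd l -> se_le (c l, d l) (0, 0) ->
      [/\ exists2 z, (U `&` interior (Q4 xbar)) z & subsolution T z,
          exists2 z, (U `&` interior (Q2 xbar)) z & subsolution T z,
          forall x, (I `&` Q4 xbar) x ->
            (fun n => iter n T x) @ \oo --> xbar &
          forall x, (I `&` interior (Q2 xbar)) x ->
            exists N : nat, forall n, (N <= n)%N -> ~ I (iter n T x)] &
      (* (iv) *)
      ~~ odd l -> se_le (0, 0) (c l, d l) ->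
      [/\ exists2 z, (U `&` interior (Q2 xbar)) z & supersolution T z,
          exists2 z, (U `&` interior (Q4 xbar)) z & supersolution T z,
          forall x, (I `&` Q2 xbar) x ->
            (fun n => iter n T x) @ \oo --> xbar &
          forall x, (I `&` interior (Q4 xbar)) x ->
            exists N : nat, forall n, (N <= n)%N -> ~ I (iter n T x)]]].
Proof.
have nD : \forall z \near xbar, D z.
  by have [a [b]] := T_analytic; apply: filterS => z [].
(* In case (a) both leading coefficients are nonzero; in (b) and (c) one is nonzero and the other
   component is affine. *)
have [c0 d0] : (c l != 0 \/ affine_near0 (fun t => (T (xbar + t *: v)).1)) /\
    (d l != 0 \/ affine_near0 (fun t => (T (xbar + t *: v)).2)).
  case: habc => [cd|[/eqP c0 aff]|[/eqP d0 aff]]; 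
    [|by split; [left|right]|by split; [right|left]].
  have : c l * d l != 0 by rewrite lt_eqF.
  by rewrite mulf_eq0 negb_or => /andP[? ?]; split; left.
have [r r0 ray] := ray_comparison T_taylor l_ge2 l_min c0 d0.
have {}ray := two_sided_ray ray.
(* The coordinates of [v] have opposite signs, so this choice points into the open second
   quadrant. *)
have [w1 w2] : (if v.1 < 0 then v else - v).1 < 0 /\ 0 < (if v.1 < 0 then v else - v).2.
  case: (ltgtP v.1 0) v_neg => [v1|v1|->]; last by rewrite mul0r ltxx.
    by rewrite nmulr_rlt0.
  by rewrite pmulr_rlt0 //= oppr_lt0 oppr_gt0.
move: ray w1 w2; set w := if v.1 < 0 then v else - v => ray w1 w2.
have [s [sr iso nI]] := isolating_interval_along xbar_fix nD w1 w2 r0.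
move: nI iso; set a := xbar + s *: w; set b := xbar - s *: w => nI iso.
have [ap pb Tp isoD] := iso.
have Dp : D xbar by case: xbar_fix.
have Da : D a by case: (isoD a (se_le_refl a) (se_le_trans ap pb)).
have Db : D b by case: (isoD b (se_le_trans ap pb) (se_le_refl b)).
have DI x : se_le a x -> se_le x b -> D x by move=> ax xb; case: (isoD x ax xb).
have pcvg : (fun n => iter n T xbar) @ \oo --> xbar.
  under eq_fun do rewrite (iter_fixed _ Tp); exact: cvg_cst.
exists [set z | se_le a z /\ se_le z b]; split.
- by exists a, b.
- split; first by move=> z [az zb]; exact: DI.
  by apply: filterS nI => z [az zb] _.
move=> U [UD nU] UI.
have {}nU : \forall z \near xbar, U z.
  by apply: filterS2 nD nU => z Dz; exact.
have [q [qr Uq2 Uq4]] := ray_witnesses nU w1 w2 r0.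
(* The orbit of [x] is squeezed between that of [a] and the constant orbit of [xbar]. *)
have Q2_cvg x : supersolution T a -> se_le a x -> se_le x xbar ->
    (fun n => iter n T x) @ \oo --> xbar.
  move=> asup ax xp.
  apply: (orbit_squeeze D_rect T_comp T_map Da _ Dp ax xp) => //.
    exact: DI (se_le_trans xp pb).
  exact: (bottom_orbit_cvg D_rect T_comp T_map iso).
have Q4_cvg x : subsolution T b -> se_le x b -> se_le xbar x ->
    (fun n => iter n T x) @ \oo --> xbar.
  move=> bsub xb px.
  apply: (orbit_squeeze D_rect T_comp T_map Dp _ Db px xb) => //.
    exact: DI (se_le_trans ap px) xb.
  exact: (top_orbit_cvg D_rect T_comp T_map iso).
have Q2_esc x : (forall s, 0 < s < r -> subsolution T (xbar + s *: w)) ->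
    se_le a x -> interior (Q2 xbar) x ->
    exists N : nat, forall n, (N <= n)%N ->
      ~ (se_le a (iter n T x) /\ se_le (iter n T x) b).
  exact: (Q2_ray_escape D_rect T_comp T_map iso w1 w2 r0).
have Q4_esc x : (forall s, 0 < s < r -> supersolution T (xbar - s *: w)) ->
    se_le x b -> interior (Q4 xbar) x ->
    exists N : nat, forall n, (N <= n)%N ->
      ~ (se_le a (iter n T x) /\ se_le (iter n T x) b).
  exact: (Q4_ray_escape D_rect T_comp T_map iso w1 w2 r0).
split=> lpar sgn; move: ray; rewrite ?lpar ?(negbTE lpar) => ray.
(* Odd order: the coefficients on the two sides are opposite, and here both half-rays move away from
   [xbar]. *)
- have := se_le_opp sgn; rewrite -[- (0, 0)]/(- 0) oppr0 => sgnN.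
  have sub t : 0 < t < r -> subsolution T (xbar + t *: w) by case/ray => /(_ sgn).
  have sup t : 0 < t < r -> supersolution T (xbar - t *: w).
    by case/ray => _ _ _; exact.
  split; [by exists (xbar - q *: w); [|exact: sup]
         |by exists (xbar + q *: w); [|exact: sub]|].
  by move=> x [[ax xb] /interior_Q2U4[xQ|xQ]]; [exact: Q2_esc|exact: Q4_esc].
- have := se_le_opp sgn; rewrite -[- (0, 0)]/(- 0) oppr0 => sgnN.
  have sup t : 0 < t < r -> supersolution T (xbar + t *: w).
    by case/ray => _ /(_ sgn).
  have sub t : 0 < t < r -> subsolution T (xbar - t *: w).
    by case/ray => _ _ /(_ sgnN).
  split; [by exists (xbar - q *: w); [|exact: sub]
         |by exists (xbar + q *: w); [|exact: sup]|].
  (* Both endpoints are attracted, so points of [I] outside the two quadrants are squeezed as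
     well. *)
  move=> x [ax xb]; apply: (orbit_squeeze D_rect T_comp T_map Da _ Db ax xb).
  + exact: DI.
  + by apply: (bottom_orbit_cvg D_rect T_comp T_map iso); exact: sup.
  + by apply: (top_orbit_cvg D_rect T_comp T_map iso); exact: sub.
(* Even order: the same sign on both sides moves the whole line one way, here towards [xbar] in the
   fourth quadrant and away from it in the second. *)
- have subP t : 0 < t < r -> subsolution T (xbar + t *: w) by case/ray => /(_ sgn).
  have subN t : 0 < t < r -> subsolution T (xbar - t *: w).
    by case/ray => _ _ /(_ sgn).
  split; [by exists (xbar - q *: w); [|exact: subN]
         |by exists (xbar + q *: w); [|exact: subP]
         |by move=> x [[ax xb] xQ]; apply: Q4_cvg => //; exact: subN
         |by move=> x [[ax xb] xQ]; exact: Q2_esc].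
- have supP t : 0 < t < r -> supersolution T (xbar + t *: w).
    by case/ray => _ /(_ sgn).
  have supN t : 0 < t < r -> supersolution T (xbar - t *: w).
    by case/ray => _ _ _; exact.
  split; [by exists (xbar + q *: w); [|exact: supP]
         |by exists (xbar - q *: w); [|exact: supN]
         |by move=> x [[ax xb] xQ]; apply: Q2_cvg => //; exact: supP
         |by move=> x [[ax xb] xQ]; exact: Q4_esc].
Qed.
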